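(* Let $M$ be a left $R$-module that is projective in $\sigma[M]$. If $M$ is a semiprime module, then $\mathrm{Ann}_M(N)=\mathrm{Ann}_M^r(N)$ for all submodules $N\subseteq M$.
   Context: $R$ is an associative ring with unity; modules are unitary left $R$-modules. For a left $R$-module $M$, a module $X$ is $M$-generated if it is an epimorphic image of a direct sum of copies of $M$, and $\sigma[M]$ is the full subcategory of left $R$-modules isomorphic to a submodule of an $M$-generated module. $M$ is projective in $\sigma[M]$ if $\mathrm{Hom}_R(M,-)$ is exact on short exact sequences in $\sigma[M]$. A submodule $K\subseteq M$ is fully invariant if $f(K)\subseteq K$ for all $f\in \mathrm{End}_R(M)$. For submodules $K,L$ of $M$, $K_ML=\sum\{f(K)\mid f\in \mathrm{Hom}_R(M,L)\}$. $M$ is a semiprime module if $M\neq 0$ and for every fully invariant submodule $K$ of $M$, $K_MK=0$ implies $K=0$. For a submodule $N$ of $M$, $\mathrm{Ann}_M(N)=\bigcap\{\ker f\mid f\in \mathrm{Hom}_R(M,N)\}$, and the right annihilator is $\mathrm{Ann}_M^r(N)=\sum\{L\subseteq M\mid N_ML=0\}$, the sum over submodules $L$ of $M$. *)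

(* Defs.v *)
From HB Require Import structures.
From mathcomp Require Import all_boot all_order all_algebra.
From mathcomp Require Import all_classical.

Set Implicit Arguments.
Unset Strict Implicit.
Unset Printing Implicit Defensive.
Import GRing.Theory.
Local Open Scope classical_set_scope.
Local Open Scope ring_scope.

(* The external direct sum M^(I): the functions I -> M of finite support, as a
   submodule of the pointwise module I -> M. *)
Definition finite_support (R : pzRingType) (M : lmodType R) (I : Type) :
    {pred I -> M} :=
  mem [set f : I -> M | finite_set [set i | f i <> 0]].

Lemma finite_support_submod (R : pzRingType) (M : lmodType R) (I : Type) :
  submod_closed (@finite_support R M I).
Proof.
split; first by apply/mem_set; apply: sub_finite_set (finite_set0 I) => i /=.
move=> a u v /set_mem uf /set_mem vf; apply/mem_set.
have uv : finite_set ([set i | u i <> 0] `|` [set i | v i <> 0]).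
  by rewrite finite_setU.
apply: sub_finite_set uv => i /=; rewrite addrfctE scalrfctE => uv0.
have [ui0|] := pselect (u i = 0); last by left.
by right => vi0; apply: uv0; rewrite ui0 vi0 scaler0 addr0.
Qed.

HB.instance Definition _ (R : pzRingType) (M : lmodType R) (I : Type) :=
  GRing.isSubmodClosed.Build R (I -> M) (@finite_support R M I)
    (@finite_support_submod R M I).

Record direct_sum (R : pzRingType) (M : lmodType R) (I : Type) := DirectSum {
  direct_sum_val :> I -> M;
  direct_sumP : direct_sum_val \in @finite_support R M I }.

HB.instance Definition _ (R : pzRingType) (M : lmodType R) (I : Type) :=
  [isSub for @direct_sum_val R M I].
HB.instance Definition _ (R : pzRingType) (M : lmodType R) (I : Type) :=
  [Choice of direct_sum M I by <:].
HB.instance Definition _ (R : pzRingType) (M : lmodType R) (I : Type) :=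
  [SubChoice_isSubLmodule of direct_sum M I by <:].

Definition generated_by (R : pzRingType) (M X : lmodType R) : Prop :=
  exists (I : Type) (p : {linear direct_sum M I -> X}), range p = [set: X].

(* X is isomorphic to a submodule of Y iff it embeds linearly into Y. *)
Definition in_sigma (R : pzRingType) (M X : lmodType R) : Prop :=
  exists (Y : lmodType R) (j : {linear X -> Y}),
    generated_by M Y /\ injective j.

Definition short_exact (R : pzRingType) (A B C : lmodType R)
    (f : {linear A -> B}) (g : {linear B -> C}) : Prop :=
  [/\ injective f, range f = g @^-1` [set 0] & range g = [set: C]].

(* Exactness of 0 -> Hom(M, A) -> Hom(M, B) -> Hom(M, C) -> 0, the maps being
   the compositions with f and g. *)
Definition Hom_short_exact (R : pzRingType) (M A B C : lmodType R)
    (f : {linear A -> B}) (g : {linear B -> C}) : Prop :=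
  [/\ forall h k : {linear M -> A}, f \o h =1 f \o k -> h =1 k,
      forall h : {linear M -> B},
        (exists k : {linear M -> A}, f \o k =1 h) <-> (g \o h =1 \0)
    & forall h : {linear M -> C}, exists k : {linear M -> B}, g \o k =1 h].

Definition projective_in_sigma (R : pzRingType) (M : lmodType R) : Prop :=
  forall (A B C : lmodType R) (f : {linear A -> B}) (g : {linear B -> C}),
    in_sigma M A -> in_sigma M B -> in_sigma M C ->
    short_exact f g -> Hom_short_exact M f g.

Definition submodule (R : pzRingType) (M : lmodType R) (N : set M) : Prop :=
  submod_closed (mem N).

(* The sum of the submodules F i, i in P: all finite sums of elements of their
   union; it is the zero submodule when P is empty. *)
Definition submodule_sum (R : pzRingType) (M : lmodType R) (I : Type)
    (P : set I) (F : I -> set M) : set M :=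
  [set x | exists s : seq M,
    [set` s] `<=` \bigcup_(i in P) F i /\ x = \sum_(y <- s) y].

(* For a submodule L of M, the elements of Hom(M, L) are encoded as the
   endomorphisms of M with range in L. *)
Definition Hom_into (R : pzRingType) (M : lmodType R) (L : set M) :
    set {linear M -> M} :=
  [set f | range f `<=` L].

Definition fully_invariant (R : pzRingType) (M : lmodType R) (K : set M) :
    Prop :=
  submodule K /\ forall f : {linear M -> M}, f @` K `<=` K.

Definition submodule_prod (R : pzRingType) (M : lmodType R) (K L : set M) :
    set M :=
  submodule_sum (Hom_into L) (fun f => f @` K).

Definition semiprime (R : pzRingType) (M : lmodType R) : Prop :=
  [set: M] <> [set 0] /\
  forall K : set M, fully_invariant K ->
    submodule_prod K K = [set 0] -> K = [set 0].

Definition annihilator (R : pzRingType) (M : lmodType R) (N : set M) :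
    set M :=
  \bigcap_(f in Hom_into N) (f @^-1` [set 0]).

Definition right_annihilator (R : pzRingType) (M : lmodType R) (N : set M) :
    set M :=
  submodule_sum [set L | submodule L /\ submodule_prod N L = [set 0]] id.

(* Main.v *)
From HB Require Import structures.
Require Import Defs.
From mathcomp Require Import all_boot all_order all_algebra.
From mathcomp Require Import finmap all_classical.

(** Write K * L for the product of K and L, the sum of the images f(K) over all
f : M -> L.  Both inclusions rest on one consequence of projectivity
([Hom_into_sum_vanish]): if L is a submodule, P a set of endomorphisms of M and
S the sum of the f(L), f in P, then every h : M -> S has the form
h = sum_f f o h_f with h_f : M -> L.  Indeed S is an epimorphic image of a
direct sum of copies of L, and h lifts along this epimorphism because all the
modules involved lie in sigma[M].  So an element killed by every map M -> L is
killed by every map M -> S.  This is the part of the associativity of the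
product that the proof uses.

Let A be the annihilator of N; it is fully invariant, and every map M -> N
kills it.

- A is one of the submodules L with N * L = 0 ([submodule_prod_annihilator]).
  The product K = N * A is a fully invariant submodule of A and a sum of images
  of N, so by the vanishing principle every map M -> K kills A, hence K.
  Thus K * K = 0, and K = 0 since M is semiprime.

- If N * L = 0, then L is contained in A ([sub_annihilator]).  The fully
  invariant closure L' = L * M of L is a sum of images of L, so by the vanishing
  principle N * L' = 0 as well.  Let K' be the fully invariant closure of
  L' * N; it lies in L'.  If h maps M to K' and g is an endomorphism, then h o g
  maps M to L', so it kills N, which contains L' * N.  Hence K' * K' = 0, so
  K' = 0, and every map M -> N kills L' and so L.

As A is a submodule, the second point shows that it contains the sum of all such
L, and the first that it is contained in this sum. *)

Set Implicit Arguments.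
Unset Strict Implicit.
Unset Printing Implicit Defensive.
Import GRing.Theory.
Local Open Scope classical_set_scope.
Local Open Scope ring_scope.

(** * Submodules and their sums *)

Lemma submoduleP (R : pzRingType) (M : lmodType R) (N : set M) :
  submodule N <->
  N 0 /\ forall (a : R) (u v : M), N u -> N v -> N (a *: u + v).
Proof.
split=> [[N0 NP]|[N0 NP]]; split.
- exact: set_mem N0.
- by move=> a u v Nu Nv; apply/set_mem/NP; apply/mem_set.
- exact/mem_set.
- by move=> a u v /set_mem Nu /set_mem Nv; apply/mem_set/NP.
Qed.

Lemma submodule_bigsum (R : pzRingType) (M : lmodType R) (N : set M)
    (s : seq M) :
  submodule N -> [set` s] `<=` N -> N (\sum_(y <- s) y).
Proof.
move=> /submoduleP[N0 NP]; elim: s => [|x s IHs] sN; first by rewrite big_nil.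
rewrite big_cons -[x]scale1r; apply: NP.
  by apply: sN; rewrite /= mem_head.
by apply: IHs => y ys; apply: sN; rewrite /= inE ys orbT.
Qed.

Lemma submodule_preimage (R : pzRingType) (M M' : lmodType R)
    (f : {linear M -> M'}) (N : set M') :
  submodule N -> submodule (f @^-1` N).
Proof.
move=> /submoduleP[N0 NP]; apply/submoduleP; split=> [|a u v Nu Nv] /=.
  by rewrite raddf0.
by rewrite linearP; apply: NP.
Qed.

Lemma submodule_image (R : pzRingType) (M M' : lmodType R)
    (f : {linear M -> M'}) (N : set M) :
  submodule N -> submodule (f @` N).
Proof.
move=> /submoduleP[N0 NP]; apply/submoduleP.
split; first by exists 0; rewrite ?raddf0.
move=> a _ _ [u Nu <-] [v Nv <-].
by exists (a *: u + v); [apply: NP | rewrite linearP].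
Qed.

Lemma submodule_setI (R : pzRingType) (M : lmodType R) (N N' : set M) :
  submodule N -> submodule N' -> submodule (N `&` N').
Proof.
move=> /submoduleP[N0 NP] /submoduleP[N'0 N'P]; apply/submoduleP.
by split=> // a u v [Nu N'u] [Nv N'v]; split; [apply: NP | apply: N'P].
Qed.

Lemma submodule_setT (R : pzRingType) (M : lmodType R) :
  submodule [set: M].
Proof. exact/submoduleP. Qed.

Lemma submodule_set0 (R : pzRingType) (M : lmodType R) :
  submodule [set (0 : M)].
Proof.
by apply/submoduleP; split=> // a _ _ -> ->; rewrite scaler0 addr0.
Qed.

Lemma submodule_sum_submodule (R : pzRingType) (M : lmodType R) (I : Type)
    (P : set I) (F : I -> set M) :
  (forall i, P i -> submodule (F i)) -> submodule (submodule_sum P F).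
Proof.
move=> FP; apply/submoduleP; split; first by exists [::]; rewrite big_nil.
move=> a _ _ [s [sF ->]] [t [tF ->]].
exists (map ( *:%R a) s ++ t); split; last first.
  by rewrite big_cat big_map scaler_sumr.
move=> y /=; rewrite mem_cat => /orP[/mapP[x xs ->]|/tF//].
have [i Pi Fx] := sF _ xs; exists i => //.
have /submoduleP[F0 /(_ a x 0 Fx F0)] := FP i Pi.
by rewrite addr0.
Qed.

Lemma sub_submodule_sum (R : pzRingType) (M : lmodType R) (I : Type)
    (P : set I) (F : I -> set M) (i : I) :
  P i -> F i `<=` submodule_sum P F.
Proof.
move=> Pi x Fx; exists [:: x]; rewrite big_seq1; split=> // y /=.
by rewrite inE => /eqP->; exists i.
Qed.

Lemma submodule_sum_sub (R : pzRingType) (M : lmodType R) (I : Type)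
    (P : set I) (F : I -> set M) (W : set M) :
  submodule W -> (forall i, P i -> F i `<=` W) -> submodule_sum P F `<=` W.
Proof.
move=> WP FW _ [s [sF ->]]; apply: submodule_bigsum WP _.
by move=> y /sF[i Pi Fy]; apply: (FW i).
Qed.

(** * Submodules as modules *)

(** The proof that N is a submodule is an argument here, and of the type below,
so that instance inference can read it off and supply the module structure. *)
Definition carrier (R : pzRingType) (M : lmodType R) (N : set M)
  (NP : submodule N) : {pred M} := mem N.

Lemma carrier_submod (R : pzRingType) (M : lmodType R) (N : set M)
  (NP : submodule N) : submod_closed (carrier NP).
Proof. exact: NP. Qed.

HB.instance Definition _ (R : pzRingType) (M : lmodType R) (N : set M)
    (NP : submodule N) :=
  GRing.isSubmodClosed.Build R M (carrier NP) (carrier_submod NP).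

Record submodule_type (R : pzRingType) (M : lmodType R) (N : set M)
    (NP : submodule N) := SubmoduleType {
  submodule_val :> M;
  submodule_valP : submodule_val \in carrier NP }.

HB.instance Definition _ (R : pzRingType) (M : lmodType R) (N : set M)
    (NP : submodule N) :=
  [isSub for @submodule_val R M N NP].
HB.instance Definition _ (R : pzRingType) (M : lmodType R) (N : set M)
    (NP : submodule N) :=
  [Choice of submodule_type NP by <:].
HB.instance Definition _ (R : pzRingType) (M : lmodType R) (N : set M)
    (NP : submodule N) :=
  [SubChoice_isSubLmodule of submodule_type NP by <:].

Definition inclusion (R : pzRingType) (M : lmodType R) (N : set M)
  (NP : submodule N) : {linear submodule_type NP -> M} := val.

Lemma inclusion_inj (R : pzRingType) (M : lmodType R) (N : set M)
  (NP : submodule N) : injective (inclusion NP).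
Proof. exact: val_inj. Qed.

Lemma inclusionP (R : pzRingType) (M : lmodType R) (N : set M)
  (NP : submodule N) (x : submodule_type NP) : N (inclusion NP x).
Proof. exact: set_mem (submodule_valP x). Qed.

Lemma corestrict (R : pzRingType) (X M : lmodType R) (N : set M)
    (NP : submodule N) (f : {linear X -> M}) :
  range f `<=` N ->
  exists g : {linear X -> submodule_type NP}, inclusion NP \o g =1 f.
Proof.
move=> fN.
have fP x : f x \in carrier NP by apply/mem_set/fN; exists x.
pose g x : submodule_type NP := SubmoduleType (fP x).
have gP : linear g by move=> a u v; apply: val_inj; rewrite /= !linearP.
pose gM := GRing.isLinear.Build R X (submodule_type NP) *:%R g gP.
pose gL : {linear X -> submodule_type NP} := HB.pack g gM.
by exists gL.
Qed.

(** * Lifting along images of submodules *)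

Lemma in_sigma_inj (R : pzRingType) (M X Y : lmodType R)
    (f : {linear X -> Y}) :
  injective f -> in_sigma M Y -> in_sigma M X.
Proof.
move=> f_inj [Z [j [ZP j_inj]]]; exists Z, (j \o f); split=> //.
exact: inj_comp.
Qed.

Lemma in_sigma_direct_sum (R : pzRingType) (M : lmodType R) (I : Type) :
  in_sigma M (direct_sum M I).
Proof.
exists (direct_sum M I), idfun; split=> //.
by exists I, idfun; apply/seteqP; split=> // x _; exists x.
Qed.

Lemma in_sigma_self (R : pzRingType) (M : lmodType R) : in_sigma M M.
Proof.
(* M is the direct sum of copies of itself over a one-element index set. *)
have cP (x : M) : (fun _ : unit => x) \in @Defs.finite_support R M unit.
  exact/mem_set/finite_finset.
pose c x := DirectSum (cP x).
have c_lin : linear c by move=> a u v; apply: val_inj.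
pose cM := GRing.isLinear.Build R M (direct_sum M unit) *:%R c c_lin.
pose cL : {linear M -> direct_sum M unit} := HB.pack c cM.
apply: (@in_sigma_inj _ _ _ _ cL); last exact: in_sigma_direct_sum.
by move=> x y /(congr1 (fun u : direct_sum M unit => u tt)).
Qed.

(** Projectivity speaks of short exact sequences of modules in sigma[M]; here it
is applied to that formed by the kernel of p on U, by U itself and by p(U), all
of which are in sigma[M] since they embed into X or Y. *)
Lemma projective_lift (R : pzRingType) (M X Y : lmodType R)
    (p : {linear X -> Y}) (U : set X) (h : {linear M -> Y}) :
  projective_in_sigma M -> in_sigma M X -> in_sigma M Y ->
  submodule U -> range h `<=` p @` U ->
  exists2 k : {linear M -> X}, range k `<=` U & p \o k =1 h.
Proof.
move=> M_proj XM YM UP hU.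
have KP := submodule_setI UP (submodule_preimage p (submodule_set0 Y)).
have VP := submodule_image p UP.
have [|f fE] := @corestrict _ (submodule_type KP) _ _ UP (inclusion KP).
  by move=> _ [x _ <-]; have [] := inclusionP x.
have [|g gE] := @corestrict _ (submodule_type UP) _ _ VP (p \o inclusion UP).
  by move=> _ [x _ <-]; exists (inclusion UP x) => //; exact: inclusionP.
have f_inj : injective f.
  by move=> x y fxy; apply: inclusion_inj; rewrite -!fE /= fxy.
have sub_sigma (Z : lmodType R) (N : set Z) (NP : submodule N) :
    in_sigma M Z -> in_sigma M (submodule_type NP).
  exact/in_sigma_inj/inclusion_inj.
have fg_exact : short_exact f g.
  split=> //.
    apply/seteqP; split=> [_ [x _ <-]|x gx0] /=.
      apply: inclusion_inj; rewrite -[LHS]/((inclusion VP \o g) (f x)) gE.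
      rewrite -[LHS]/(p ((inclusion UP \o f) x)) fE.
      by have [_ ->] := inclusionP x; exact: esym (raddf0 (inclusion VP)).
    have Kx : (U `&` p @^-1` [set 0]) (inclusion UP x).
      split; first exact: inclusionP.
      by rewrite /= -[LHS]gE /= gx0.
    exists (SubmoduleType (mem_set Kx : _ \in carrier KP)) => //.
    by apply: inclusion_inj; exact: fE.
  apply/seteqP; split=> // y _.
  have [x Ux pxy] := inclusionP y.
  exists (SubmoduleType (mem_set Ux : _ \in carrier UP)) => //.
  by apply: inclusion_inj; rewrite -pxy; exact: gE.
have [_ _ lift] := M_proj _ _ _ f g (sub_sigma _ _ KP XM) (sub_sigma _ _ UP XM)
  (sub_sigma _ _ VP YM) fg_exact.
have [h' h'E] := corestrict VP hU.
have [k kE] := lift h'.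
exists (inclusion UP \o k) => [_ [x _ <-]|x]; first exact: inclusionP.
by rewrite -h'E /= -kE; exact: esym (gE _).
Qed.

(** * Maps out of direct sums *)

Definition component (R : pzRingType) (M : lmodType R) (I : Type) (i : I)
  (u : direct_sum M I) : M := u i.

Lemma component_linear (R : pzRingType) (M : lmodType R) (I : Type) (i : I) :
  linear (@component R M I i).
Proof. by []. Qed.

HB.instance Definition _ (R : pzRingType) (M : lmodType R) (I : Type) (i : I) :=
  GRing.isLinear.Build R (direct_sum M I) M *:%R (@component R M I i)
    (@component_linear R M I i).

(** The sum has finitely many nonzero terms, since u has finite support. *)
Definition copairing (R : pzRingType) (M Y : lmodType R) (I : choiceType)
  (f : I -> {linear M -> Y}) (u : direct_sum M I) : Y :=
  \sum_(i \in [set: I]) f i (u i).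

Lemma copairing_linear (R : pzRingType) (M Y : lmodType R) (I : choiceType)
  (f : I -> {linear M -> Y}) : linear (copairing f).
Proof.
move=> a u v; rewrite /copairing.
have uF := set_mem (direct_sumP u); have vF := set_mem (direct_sumP v).
(* A finite set of indices common to u and v, and so to a *: u + v, turns the
   three sums into ordinary ones over the same range. *)
pose X := (fset_set [set i | u i <> 0] `|` fset_set [set i | v i <> 0])%fset.
have uX i : i \notin X -> u i = 0.
  rewrite in_fsetU !in_fset_set// => /norP[+ _]; apply: contraNP => ui0.
  exact/mem_set.
have vX i : i \notin X -> v i = 0.
  rewrite in_fsetU !in_fset_set// => /norP[_]; apply: contraNP => vi0.
  exact/mem_set.
rewrite !(@fsbigTE _ _ _ _ X) => [|i /vX->|i /uX->|i iX]; rewrite ?raddf0//.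
  rewrite scaler_sumr -big_split; apply: eq_bigr => i _.
  by rewrite [X in f i X](component_linear i a u v) linearP.
rewrite [X in f i X](component_linear i a u v) linearP /component uX ?vX//.
by rewrite raddf0 scaler0 addr0.
Qed.

HB.instance Definition _ (R : pzRingType) (M Y : lmodType R) (I : choiceType)
    (f : I -> {linear M -> Y}) :=
  GRing.isLinear.Build R (direct_sum M I) Y *:%R (copairing f)
    (copairing_linear f).

Lemma direct_sum_single (R : pzRingType) (M : lmodType R) (I : choiceType)
    (i : I) (x : M) :
  exists u : direct_sum M I, forall j, u j = if j == i then x else 0.
Proof.
have uP : (fun j => if j == i then x else 0) \in @Defs.finite_support R M I.
  apply/mem_set; apply: sub_finite_set (finite_set1 i) => j /=.
  by case: eqP.
by exists (DirectSum uP).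
Qed.

Lemma submodule_direct_sum (R : pzRingType) (M : lmodType R) (I : Type)
    (L : set M) :
  submodule L -> submodule [set u : direct_sum M I | forall i, L (u i)].
Proof.
move=> /submoduleP[L0 LL]; apply/submoduleP; split=> // a u v Lu Lv i.
exact: LL (Lu i) (Lv i).
Qed.

Lemma copairing_image (R : pzRingType) (M Y : lmodType R) (I : choiceType)
    (f : I -> {linear M -> Y}) (L : set M) :
  submodule L ->
  submodule_sum setT (fun i => f i @` L) `<=`
  copairing f @` [set u : direct_sum M I | forall i, L (u i)].
Proof.
move=> LP; have UP := submodule_direct_sum I LP.
have /submoduleP[L0 _] := LP.
apply: submodule_sum_sub (submodule_image _ UP) _ => i _ _ [x Lx <-].
have [u uE] := direct_sum_single i x; exists u.
  by move=> j; rewrite uE; case: ifP.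
rewrite /= /copairing (@fsbigTE _ _ _ _ [fset i]%fset) => [|j].
  by rewrite big_seq_fset1 uE eqxx.
by rewrite inE uE => /negPf->; rewrite raddf0.
Qed.

(** A map h into the sum of the images f(L), f in P, lifts to the families in
M^(P) with entries in L: this writes h as a pointwise finite sum of the f o h_f,
h_f being the component at f of the lift, a map into L.  So h vanishes where
all maps into L do. *)
Lemma Hom_into_sum_vanish (R : pzRingType) (M : lmodType R)
    (P : set {linear M -> M}) (L : set M) (x : M) :
  projective_in_sigma M -> submodule L ->
  (forall k, Hom_into L k -> k x = 0) ->
  forall h, Hom_into (submodule_sum P (fun f => f @` L)) h -> h x = 0.
Proof.
move=> M_proj LP Lx h hS.
(* Finitely supported sums are indexed by a type with a choice operator. *)
pose I : choiceType := {classic {f : {linear M -> M} | P f}}.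
pose f (i : I) : {linear M -> M} := sval i.
have UP := submodule_direct_sum I LP.
have [|k kU kE] := @projective_lift _ _ _ _ (copairing f) _ h M_proj
  (in_sigma_direct_sum M I) (in_sigma_self M) UP.
  apply: subset_trans hS _; apply: subset_trans (copairing_image LP).
  apply: submodule_sum_sub => [|g Pg].
    by apply: submodule_sum_submodule => i _; exact: submodule_image.
  exact: (@sub_submodule_sum _ _ _ setT (fun i => f i @` L) (exist _ g Pg)).
rewrite -kE /= /copairing fsbig1// => i _.
have kxi0 : k x i = 0.
  apply: (Lx (component i \o k)) => _ [y _ <-].
  by apply: (kU (k y)); exists y.
by rewrite kxi0 raddf0.
Qed.

(** * Products of submodules *)

Lemma submodule_prod_submodule (R : pzRingType) (M : lmodType R)
    (K L : set M) :
  submodule K -> submodule (submodule_prod K L).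
Proof.
by move=> KP; apply: submodule_sum_submodule => f _; exact: submodule_image.
Qed.

Lemma submodule_prodI (R : pzRingType) (M : lmodType R) (K L : set M)
    (f : {linear M -> M}) (x : M) :
  Hom_into L f -> K x -> submodule_prod K L (f x).
Proof. by move=> fL Kx; apply: (sub_submodule_sum fL); exists x. Qed.

Lemma submodule_prod_subr (R : pzRingType) (M : lmodType R) (K L : set M) :
  submodule L -> submodule_prod K L `<=` L.
Proof.
move=> LP; apply: submodule_sum_sub => // f fL _ [x _ <-].
by apply: fL; exists x.
Qed.

Lemma submodule_prod_fully_invariant (R : pzRingType) (M : lmodType R)
    (K L : set M) :
  submodule K -> fully_invariant L -> fully_invariant (submodule_prod K L).
Proof.
move=> KP [_ LL]; have KLP := submodule_prod_submodule L KP; split=> // g.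
rewrite image_sub.
apply: submodule_sum_sub; first exact: submodule_preimage.
move=> f fL _ [x Kx <-]; apply: (@submodule_prodI _ _ _ _ (g \o f)) => //.
by move=> _ [y _ <-]; apply: (LL g); exists (f y) => //; apply: fL; exists y.
Qed.

Lemma fully_invariant_setT (R : pzRingType) (M : lmodType R) :
  fully_invariant [set: M].
Proof. by split=> //; exact: submodule_setT. Qed.

Lemma submodule_prod_eq0P (R : pzRingType) (M : lmodType R) (K L : set M) :
  submodule_prod K L = [set 0] <->
  forall f, Hom_into L f -> K `<=` f @^-1` [set 0].
Proof.
split=> [KL0 f fL x Kx|KL0].
  by rewrite -KL0; exact: submodule_prodI.
apply/seteqP; split=> [|_ ->]; last by exists [::]; rewrite big_nil.
apply: submodule_sum_sub (submodule_set0 M) _ => f fL.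
by rewrite image_sub; exact: KL0.
Qed.

(** * The two annihilators *)

Lemma annihilator_fully_invariant (R : pzRingType) (M : lmodType R)
    (N : set M) :
  fully_invariant (annihilator N).
Proof.
split=> [|g _ [x Ax <-] f fN]; last first.
  by apply: (Ax (f \o g)) => _ [y _ <-]; apply: fN; exists (g y).
apply/submoduleP; split=> [f _|a u v Au Av f fN] /=; first by rewrite raddf0.
by rewrite linearP (Au f fN) (Av f fN) scaler0 addr0.
Qed.

(** The product K of N and A = annihilator N squares to zero: a map into K,
which is a sum of images of N, vanishes wherever the maps into N do, that is on
A, and A contains K. *)
Lemma submodule_prod_annihilator (R : pzRingType) (M : lmodType R)
    (N : set M) :
  projective_in_sigma M -> semiprime M -> submodule N ->
  submodule_prod N (annihilator N) = [set 0].
Proof.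
move=> M_proj [_ M_semi] NP.
have AI := annihilator_fully_invariant N.
apply: M_semi; first exact: submodule_prod_fully_invariant.
apply/submodule_prod_eq0P => h hK x Kx.
apply: (Hom_into_sum_vanish M_proj NP) hK => k kN.
exact: (submodule_prod_subr AI.1 Kx) k kN.
Qed.

(** Semiprimeness only concerns fully invariant submodules, so L and then its
product with N are replaced by their fully invariant closures, the products with
M; projectivity makes the hypothesis on L pass to its closure. *)
Lemma sub_annihilator (R : pzRingType) (M : lmodType R) (N L : set M) :
  projective_in_sigma M -> semiprime M -> submodule N -> submodule L ->
  submodule_prod N L = [set 0] -> L `<=` annihilator N.
Proof.
move=> M_proj [_ M_semi] NP LP /submodule_prod_eq0P NL0 x Lx f fN.
have TI := fully_invariant_setT M.
pose L' := submodule_prod L setT.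
have L'I : fully_invariant L' by exact: submodule_prod_fully_invariant.
pose K := submodule_prod L' N.
have KP : submodule K by apply: submodule_prod_submodule; exact: L'I.1.
pose K' := submodule_prod K setT.
have subT (A : set M) : A `<=` submodule_prod A setT.
  by move=> y Ay; exact: (@submodule_prodI _ _ _ _ idfun).
have NL'0 h : Hom_into L' h -> N `<=` h @^-1` [set 0].
  move=> hL' y Ny; apply: (Hom_into_sum_vanish M_proj LP) hL' => k kL.
  exact: NL0 Ny.
have K'L' : K' `<=` L'.
  apply: submodule_sum_sub L'I.1 _ => g _; rewrite image_sub.
  apply: submodule_sum_sub => [|e _ _ [y L'y <-]].
    by apply: submodule_preimage; exact: L'I.1.
  by apply: (L'I.2 (g \o e)); exists y.
have K'0 : K' = [set 0].
  apply: M_semi; first exact: submodule_prod_fully_invariant.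
  apply/submodule_prod_eq0P => h hK'.
  apply: submodule_sum_sub; first exact/submodule_preimage/submodule_set0.
  move=> g _ _ [y Ky <-]; apply: (NL'0 (h \o g)).
    by move=> _ [z _ <-]; apply/K'L'/hK'; exists (g z).
  exact: submodule_prod_subr Ky.
rewrite -K'0; exact/subT/(submodule_prodI fN)/subT.
Qed.

Theorem proposition1p16 (R : pzRingType) (M : lmodType R)
    (M_projective : projective_in_sigma M) (M_semiprime : semiprime M) :
  forall N : set M, submodule N -> annihilator N = right_annihilator N.
Proof.
move=> N NP; have [AP _] := annihilator_fully_invariant N.
apply/seteqP; split.
  apply: (sub_submodule_sum (F := id)); split=> //.
  exact: submodule_prod_annihilator.
apply: submodule_sum_sub AP _ => L [LP NL0].
exact: sub_annihilator.
Qed.
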